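(* Let $\mathcal{H}$ be a finite hypergraph. Then, as formal power series in $\mathbb{Z}[\![\sqrt{q}]\!]$, $$\sum_{n,l\geq 0}(-1)^{n}\,\mathrm{rank}\big(\mathbf{MH}_{n,l}(\mathcal{H})\big)\, q^{l}=\#\mathcal{H},$$ where $n$ ranges over the nonnegative elements of $\mathbb{Z}$ and $l$ over the nonnegative elements of $\tfrac12\mathbb{Z}$.
   Context: A hypergraph $\mathcal{H}$ is a collection of nonempty finite subsets (hyperedges) of a vertex set. A path from a hyperedge $\sigma$ to a hyperedge $\tau$ is a sequence of hyperedges $\gamma=\sigma_0\sigma_1\cdots\sigma_k$ ($k\ge 0$) of $\mathcal{H}$ with $\sigma_0=\sigma$, $\sigma_k=\tau$ and $\sigma_i\cap\sigma_{i+1}\neq\emptyset$ for $0\le i\le k-1$. Its length is $\ell(\gamma)=\sum_{i=0}^{k-1}\ell(\sigma_i,\sigma_{i+1})$, where for $\sigma\cap\tau\ne\emptyset$: $\ell(\sigma,\tau)=0$ if $\sigma=\tau$; $\ell(\sigma,\tau)=\tfrac12$ if $\sigma\subsetneq\tau$ or $\tau\subsetneq\sigma$; $\ell(\sigma,\tau)=1$ otherwise. The intercrossing distance is $d(\sigma,\tau)=\inf_\gamma \ell(\gamma)$ over all paths $\gamma$ from $\sigma$ to $\tau$ on $\mathcal{H}$, with $d(\sigma,\tau)=\infty$ if there is no path. Magnitude: $Z_{\mathcal{H}}(q)$ is the square matrix indexed by the hyperedges of $\mathcal{H}$ with entries $q^{d(\sigma,\tau)}\in\mathbb{Z}[\sqrt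 q]$ (convention $q^\infty=0$). It is invertible over $\mathbb{Q}(\sqrt q)$ and over $\mathbb{Z}[\![\sqrt q]\!]$. The magnitude $\#\mathcal{H}$ is the sum of all entries of $Z_{\mathcal{H}}(q)^{-1}$, an element of $\mathbb{Q}(\sqrt q)$ that can be regarded as an element of $\mathbb{Z}[\![\sqrt q]\!]$. Magnitude homology (coefficients in $\mathbb{Z}$): the length of a tuple of hyperedges is $\mathcal{L}(\sigma_0,\dots,\sigma_k)=d(\sigma_0,\sigma_1)+\cdots+d(\sigma_{k-1},\sigma_k)$. $\mathbf{MC}_{k,l}(\mathcal{H})$ is the free abelian group on tuples $(\sigma_0,\dots,\sigma_k)$ of hyperedges with $\sigma_{i-1}\ne\sigma_i$ for all $1\le i\le k$ and $\mathcal{L}(\sigma_0,\dots,\sigma_k)=l$. The differential $\partial_l:\mathbf{MC}_{k,l}(\mathcal{H})\to\mathbf{MC}_{k-1,l}(\mathcal{H})$ is $\partial_l=\sum_{i=0}^k(-1)^i\partial_{i,l}$, where $\partial_{i,l}(\sigma_0,\dots,\sigma_k)=(\sigma_0,\dots,\widehat{\sigma_i},\dots,\sigma_k)$ if $\mathcal{L}(\sigma_0,\dots,\widehat{\sigma_i},\dots,\sigma_k)=l$ and $0$ otherwise. $\mathbf{MH}_{k,l}(\mathcal{H})$ is the $k$-th homology of $\mathbf{MC}_{*,l}(\mathcal{H})$. *)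

(* Defs.v *)
From HB Require Import structures.
From mathcomp Require Import all_boot all_order all_algebra.
From mathcomp Require Import finmap.
From mathcomp Require Import boolp.

Set Implicit Arguments.
Unset Strict Implicit.
Unset Printing Implicit Defensive.

Import GRing.Theory.
Local Open Scope fset_scope.
Local Open Scope ring_scope.

(* All lengths, distances and gradings lie in (1/2)Z; they are represented by *)
(* natural numbers counting half-units: m : nat stands for the length m/2.    *)
(* Accordingly the variable of all polynomials and power series is sqrt q,    *)
(* so that its m-th power is q^(m/2). Possibly infinite distances are in      *)
(* option nat, None standing for infinity.                                    *)

Section Distance.

Variables (V : choiceType) (H : {fset {fset V}}).
Implicit Types s t : H.

Definition meets : rel H := [rel s t | val s `&` val t != fset0].

Definition step_length s t : nat :=
  if s == t then 0%N
  else if (val s `<` val t) || (val t `<` val s) then 1%N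
  else 2%N.

(* A path is given by its first hyperedge s and the sequence p of the others. *)
Definition is_path s p t := path meets s p && (last s p == t).

Definition path_length s (p : seq H) : nat := sumn (pairmap step_length s p).

Definition has_path_of_length s t (m : nat) : bool :=
  `[< exists2 p, is_path s p t & path_length s p = m >].

Definition dist s t : option nat :=
  if pselect (exists m, has_path_of_length s t m) is left ex
  then Some (ex_minn ex) else None.

Definition oaddn (a b : option nat) : option nat :=
  if a is Some m then if b is Some n then Some (m + n)%N else None else None.

Definition tuple_length (x : seq H) : option nat :=
  if x is s :: p then foldr oaddn (Some 0%N) (pairmap dist s p) else Some 0%N.

End Distance.

Section Magnitude.

Variables (V : choiceType) (H : {fset {fset V}}).

Definition qpow (d : option nat) : {fraction {poly rat}} :=
  if d is Some m then FracField.tofrac 'X^m else 0.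

Definition Zmx : 'M[{fraction {poly rat}}]_#|{: H}| :=
  \matrix_(i, j) qpow (dist (enum_val i) (enum_val j)).

Definition magnitude : {fraction {poly rat}} :=
  \sum_i \sum_j invmx Zmx i j.

End Magnitude.

(* The rational function f is regular at 0 and its power series expansion is  *)
(* the series with integral coefficients s: f = p / d with d(0) != 0, and     *)
(* d * s = p (Cauchy product).                                                *)
Definition expands_to (f : {fraction {poly rat}}) (s : nat -> int) : Prop :=
  exists p d : {poly rat},
    [/\ d`_0 != 0, f = FracField.tofrac p / FracField.tofrac d &
        forall m, \sum_(i < m.+1) d`_i * (s (m - i)%N)%:~R = p`_m].

Lemma expands_to_uniq f s s' : expands_to f s -> expands_to f s' -> s =1 s'.
Proof.
have eval0N (p : {poly rat}) : p`_0 != 0 -> FracField.tofrac p != 0.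
  by rewrite tofrac_eq0; apply: contraNneq => ->; rewrite coef0.
have coefM_lt N (a b c : {poly rat}) :
    (forall m, (m < N)%N -> b`_m = c`_m) ->
    forall m, (m < N)%N -> (a * b)`_m = (a * c)`_m.
  move=> bc m mN; rewrite !coefM; apply: eq_bigr => i _.
  by rewrite bc // (leq_ltn_trans (leq_subr _ _)).
case=> p [d [d0 fE ds]] [p' [d' [d'0 f'E ds']]] n.
have pd : p * d' = p' * d.
  apply/eqP; rewrite -tofrac_eq !tofracM.
  by rewrite -eqr_div ?eval0N // -fE -f'E.
pose tr (t : nat -> int) : {poly rat} := \poly_(i < n.+1) (t i)%:~R.
have trE (d1 p1 : {poly rat}) t :
    (forall m, \sum_(i < m.+1) d1`_i * (t (m - i)%N)%:~R = p1`_m) ->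
    forall m, (m < n.+1)%N -> (d1 * tr t)`_m = p1`_m.
  move=> dt m mn; rewrite coefM -dt; apply: eq_bigr => i _.
  by rewrite coef_poly (leq_ltn_trans (leq_subr _ _)).
have /(_ _ _)/subr0_eq ddE m : (m < n.+1)%N ->
    (d * d' * tr s)`_m - (d * d' * tr s')`_m = 0.
  move=> mn; apply/eqP; rewrite subr_eq0 -mulrA mulrCA.
  rewrite (coefM_lt _ d' _ _ (trE _ _ _ ds)) // mulrC pd mulrC -mulrA.
  by rewrite (coefM_lt _ d _ _ (trE _ _ _ ds')).
suff: (tr s)`_n = (tr s')`_n.
  by rewrite !coef_poly ltnSn => /intr_inj.
elim/ltn_ind: {-2}n (leqnn n) => m IH mn.
have := ddE m mn; rewrite !coefM !big_ord_recl /= !subn0.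
rewrite [X in _ + X = _ -> _](_ : _ = \sum_(i < m)
   (d * d')`_(bump 0 i) * (tr s')`_(m - bump 0 i)); last first.
  apply: eq_bigr => i _; rewrite IH //.
    by rewrite /bump /= ltn_subrL add1n (leq_ltn_trans _ (ltn_ord i)).
  by rewrite (leq_trans (leq_subr _ _)).
move=> /addIr/mulfI; apply.
by rewrite coefM big_ord1 mulf_neq0.
Qed.

(* The family of monomials a n m * (sqrt q)^m, for n and m in nat, is         *)
(* summable in Z[[sqrt q]] (finitely many nonzero terms for each exponent m)  *)
(* and its sum is the series with coefficients s.                             *)
Definition monomials_sum_to (a : nat -> nat -> int) (s : nat -> int) : Prop :=
  forall m, exists2 N,
    (forall n, (N <= n)%N -> a n m = 0) & s m = \sum_(n < N) a n m.

Section Homology.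

Variables (A B C : zmodType) (f : {additive A -> B}) (g : {additive B -> C}).

Definition cycle : pred B := [pred x | g x == 0].

Fact cycle_zmod_closed : zmod_closed cycle.
Proof.
split=> [|x y]; rewrite !inE ?raddf0 //.
by move=> /eqP gx /eqP gy; rewrite raddfB gx gy subrr.
Qed.
HB.instance Definition _ := GRing.isZmodClosed.Build B cycle cycle_zmod_closed.

Definition cycles := {x : B | cycle x}.
HB.instance Definition _ := SubType.on cycles.
HB.instance Definition _ := Choice.on cycles.
HB.instance Definition _ := [SubChoice_isSubZmodule of cycles by <:].

Definition boundary : pred cycles := fun x => `[< exists a, f a = val x >].

Fact boundary_zmod_closed : zmod_closed boundary.
Proof.
split=> [|x y]; first by apply/asboolP; exists 0; rewrite !raddf0.
move=> /asboolP[a fa] /asboolP[b fb].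
by apply/asboolP; exists (a - b); rewrite !raddfB fa fb.
Qed.
HB.instance Definition _ :=
  GRing.isZmodClosed.Build cycles boundary boundary_zmod_closed.

(* ker g / (ker g :&: im f), that is ker g / im f when g \o f = 0.             *)
Definition homology : zmodType := Quotient.quot (GRing.ZmodClosed.clone cycles boundary _).

End Homology.

Section Rank.

Variable A : zmodType.

Definition Zfree (r : nat) (v : 'I_r -> A) : Prop :=
  forall c : 'I_r -> int, \sum_i v i *~ c i = 0 -> forall i, c i = 0.

Definition is_zrank (r : nat) : Prop :=
  (exists v : 'I_r -> A, Zfree v) /\
  (forall r' (v : 'I_r' -> A), Zfree v -> (r' <= r)%N).

(* The maximal number of Z-linearly independent elements of A, with the       *)
(* default value 0 if there is no maximum.                                    *)
Definition zrank : nat :=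
  if pselect (exists r, is_zrank r) is left ex then projT1 (cid ex) else 0%N.

End Rank.

Section MagnitudeHomology.

Variables (V : choiceType) (H : {fset {fset V}}).

Definition MC_gen (k m : nat) (x : k.+1.-tuple H) : bool :=
  sorted (fun s t : H => s != t) x && (tuple_length x == Some m).

Definition MC_basis k m := {x : k.+1.-tuple H | MC_gen m x}.
HB.instance Definition _ k m := SubType.on (MC_basis k m).
HB.instance Definition _ k m := Finite.on (MC_basis k m).

Definition MC k m := {ffun MC_basis k m -> int}.
HB.instance Definition _ k m := GRing.Zmodule.on (MC k m).

Definition omit k (i : 'I_k.+2) (x : k.+2.-tuple H) : k.+1.-tuple H :=
  [tuple tnth x (lift i j) | j < k.+1].

Definition MC_of_gen k m (x : MC_basis k m) : MC k m := [ffun y => (x == y)%:Z].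

(* By the triangle inequality, omitting an entry of a generator of length m   *)
(* can only give a tuple of length m if its consecutive entries are distinct, *)
(* so that the test made by insub amounts to a test of the length.            *)
Definition MC_face k m (i : 'I_k.+2) (x : MC_basis k.+1 m) : MC k m :=
  if insub (omit i (val x)) is Some y then MC_of_gen y else 0.

Definition MC_bd k m (c : MC k.+1 m) : MC k m :=
  \sum_x (\sum_(i < k.+2) MC_face i x *~ (-1) ^+ i) *~ c x.

Fact MC_bd_is_zmod_morphism k m : zmod_morphism (@MC_bd k m).
Proof.
move=> b c; rewrite -sumrB; apply: eq_bigr => x _.
by rewrite -mulrzBr !ffunE.
Qed.
HB.instance Definition _ k m :=
  GRing.isZmodMorphism.Build (MC k.+1 m) (MC k m) (@MC_bd k m)
    (@MC_bd_is_zmod_morphism k m).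

(* The differential on MC_0 is zero. *)
Definition MH k m : zmodType :=
  match k with
  | 0 => homology (@MC_bd 0 m) (\0%R : MC 0 m -> MC 0 m)
  | k'.+1 => homology (@MC_bd k'.+1 m) (@MC_bd k' m)
  end.

End MagnitudeHomology.

(* Main.v *)
Require Import Defs.
From HB Require Import structures.
From mathcomp Require Import all_boot all_order all_algebra.
From mathcomp Require Import finmap.
From mathcomp Require Import boolp zify.

(* Over Q the rank of H_n is dim C_n - rank d_n - rank d_(n+1), so for each   *)
(* length m the alternating sum of the ranks telescopes to that of the        *)
(* numbers of generators of MC_(n, m), which vanish for n > m because         *)
(* distinct hyperedges are at least a half-unit apart. On the other side      *)
(* Z = 1 + W where every entry of W is divisible by sqrt q, so that           *)
(* Z^-1 = \sum_n (-W)^n as power series, and the coefficient of (sqrt q)^m in *)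
(* the sum of the entries of W^n counts the same generators.                  *)

Set Implicit Arguments.
Unset Strict Implicit.
Unset Printing Implicit Defensive.

Import GRing.Theory Num.Theory.
Local Open Scope fset_scope.
Local Open Scope ring_scope.

(** * Ranks of homology groups of free abelian groups *)

(** For each exponent [m] both sides have the coefficient [euler_coef H m], the Euler characteristic
    of the finite complex of generators of length [m].

    On the homology side, [zrank_homology] is rank-nullity over Q, transferred to Z by clearing
    denominators. It applies because consecutive boundaries compose to zero ([MC_bd_bd]). Since
    faces of the wrong length are discarded, this needs more than the simplicial identity: by
    [tuple_length_del], deletions never lengthen a tuple, so length lost at one deletion is not
    regained at the next. The telescoping is [sum_zrank_MH].

    On the magnitude side, powers of the off-diagonal part of the matrix sum the weights of walks
    ([mx_expr_row_sum]), whence the count of generators in [coef_sum_Wmx_exp]. No inverse over power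
    series is formed: the magnitude is written with the adjugate over the determinant
    ([magnitudeE]), and [expands_to_magnitude] compares the adjugate with the determinant times a
    finite geometric sum. *)

Lemma zrank_eq (A : zmodType) (r : nat) : is_zrank A r -> zrank A = r.
Proof.
move=> [[v vfree] rmax]; rewrite /zrank.
case: pselect => [ex|[]]; last by exists r; split=> //; exists v.
case: (cid ex) => r' /= [[v' v'free] r'max]; apply/eqP.
by rewrite eqn_leq (rmax _ v') // (r'max _ v).
Qed.

Section HomologyPi.

Variables (A B C : zmodType) (f : {additive A -> B}) (g : {additive B -> C}).

Definition homology_class (z : cycles g) : homology f g :=
  \pi_(homology f g)%qT z.

Lemma homology_class_is_zmod_morphism : zmod_morphism homology_class.
Proof. by move=> x y; rewrite /homology_class [LHS]raddfB. Qed.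
HB.instance Definition _ :=
  GRing.isZmodMorphism.Build _ _ _ homology_class_is_zmod_morphism.

Lemma homology_class_eq0 (z : cycles g) :
  (homology_class z == 0) = `[< exists a, f a = val z >].
Proof.
rewrite -[0](raddf0 homology_class) /homology_class.
by rewrite -Quotient.idealrBE subr0.
Qed.

Lemma homology_classP (h : homology f g) : exists z, h = homology_class z.
Proof. by exists (repr h); rewrite /homology_class reprK. Qed.

(** A combination of classes vanishes exactly when the same combination of cycles is a boundary.
    This moves independence from the quotient to chains, where linear algebra applies. *)
Lemma Zfree_homology_class r (z : 'I_r -> cycles g) :
  Zfree (fun i => homology_class (z i)) <->
  (forall (c : 'I_r -> int) a, f a = \sum_i val (z i) *~ c i ->
     forall i, c i = 0).
Proof.
have classE (c : 'I_r -> int) : \sum_i homology_class (z i) *~ c i = 0 <->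
    exists a, f a = \sum_i val (z i) *~ c i.
  under eq_bigr do rewrite -raddfMz.
  rewrite -raddf_sum; split.
    move=> /eqP; rewrite homology_class_eq0 => /asboolP[a fa]; exists a.
    by rewrite fa raddf_sum; apply: eq_bigr => i _; rewrite raddfMz.
  move=> [a fa]; apply/eqP; rewrite homology_class_eq0; apply/asboolP; exists a.
  by rewrite fa raddf_sum; apply: eq_bigr => i _; rewrite raddfMz.
split=> [zfree c a fa|zfree c /classE[a fa]]; last exact: zfree fa.
by apply/zfree/classE; exists a.
Qed.

End HomologyPi.

Section RationalRows.

Implicit Types I J : finType.

Definition qrow I (c : {ffun I -> int}) : 'rV[rat]_#|I| :=
  \row_j (c (enum_val j))%:~R.

Lemma qrow_is_zmod_morphism I : zmod_morphism (@qrow I).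
Proof. by move=> b c; apply/rowP => j; rewrite !mxE !ffunE rmorphB. Qed.
HB.instance Definition _ I :=
  GRing.isZmodMorphism.Build _ _ (@qrow I) (@qrow_is_zmod_morphism I).

Lemma qrow_inj I : injective (@qrow I).
Proof.
move=> b c /rowP bc; apply/ffunP => i; have := bc (enum_rank i).
by rewrite !mxE enum_rankK => /intr_inj.
Qed.

(** Matrices act on row vectors from the right, so the row space of [qmx f] is the rational image of
    [f] and [kermx (qmx f)] its rational kernel. *)
Definition qmx I J (f : {ffun I -> int} -> {ffun J -> int}) :
    'M[rat]_(#|I|, #|J|) :=
  \matrix_i qrow (f [ffun k => (enum_val i == k)%:Z]).

Lemma qrow_qmx I J (f : {additive {ffun I -> int} -> {ffun J -> int}}) a :
  qrow a *m qmx f = qrow (f a).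
Proof.
have {2}-> :
    a = \sum_(i < #|I|) [ffun k => (enum_val i == k)%:Z] *~ a (enum_val i).
  apply/ffunP => k; rewrite sum_ffunE (bigD1 (enum_rank k)) //= big1 => [|i].
    by rewrite addr0 ffunMzE ffunE enum_rankK eqxx intz.
  rewrite -(inj_eq enum_val_inj) enum_rankK ffunMzE ffunE.
  by move=> /negPf ->; rewrite mul0rz.
rewrite mulmx_sum_row !raddf_sum; apply: eq_bigr => i _ /=.
by rewrite rowK !raddfMz mxE scaler_int.
Qed.

Lemma clear_denominators I (u : 'rV[rat]_#|I|) :
  exists2 d : int, d != 0 & exists c : {ffun I -> int}, qrow c = d%:~R *: u.
Proof.
exists (\prod_j denq (u 0 j)).
  by apply/prodf_neq0 => j _; rewrite denq_neq0.
exists [ffun i => numq (u 0 (enum_rank i))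
                  * \prod_(j | j != enum_rank i) denq (u 0 j)].
apply/rowP => j; rewrite !mxE ffunE enum_valK [in RHS](bigD1 j) //= !intrM.
by rewrite numqE [RHS]mulrAC [u 0 j * _]mulrC.
Qed.

(** The rank is the dimension of rational homology. A rational basis of a complement of the image in
    the kernel scales to independent integral classes; conversely, independent integral classes stay
    independent over Q modulo the image, which bounds their number. *)
Lemma zrank_homology (I J K : finType)
    (f : {additive {ffun I -> int} -> {ffun J -> int}})
    (g : {additive {ffun J -> int} -> {ffun K -> int}}) :
    (forall a, g (f a) = 0) ->
  (zrank (homology f g) + \rank (qmx f) + \rank (qmx g))%N = #|J|.
Proof.
move=> gf0.
have sub_fg : (qmx f <= kermx (qmx g))%MS.
  apply/row_subP => i; apply/sub_kermxP.
  by rewrite rowK qrow_qmx gf0 raddf0.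
pose r := \rank (kermx (qmx g) :\: qmx f).
suff /zrank_eq -> : is_zrank (homology f g) r.
  have := mxrank_cap_compl (kermx (qmx g)) (qmx f).
  rewrite -/r (capmx_idPr sub_fg) mxrank_ker addnC => ->.
  by rewrite subnK // rank_leq_row.
have qrow_sum n (z : 'I_n -> cycles g) (c : {ffun 'I_n -> int}) :
    qrow (\sum_i val (z i) *~ c i) =
    \row_i (c i)%:~R *m \matrix_i qrow (val (z i)).
  rewrite mulmx_sum_row raddf_sum; apply: eq_bigr => i _.
  by rewrite rowK raddfMz mxE scaler_int.
split.
  (* Lower bound: each basis vector of the complement is multiplied by its own nonzero integer to
     become an integral cycle. *)
  pose M := row_base (kermx (qmx g) :\: qmx f)%MS.
  pose scaled i (dc : int * {ffun J -> int}) :=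
    dc.1 != 0 /\ qrow dc.2 = dc.1%:~R *: row i M.
  have /choice[dc dcP] i : exists dc, scaled i dc.
    by have [d d0 [c cE]] := clear_denominators (row i M); exists (d, c).
  have subM : (M <= kermx (qmx g) :\: qmx f)%MS by rewrite eq_row_base.
  have dc_cycle i : Defs.cycle g (dc i).2.
    apply/eqP/qrow_inj; rewrite -qrow_qmx (dcP i).2 raddf0.
    rewrite -scalemxAl (_ : row i M *m _ = 0) ?scaler0 //; apply/sub_kermxP.
    exact: submx_trans (row_sub _ _) (submx_trans subM (diffmxSl _ _)).
  exists (fun i =>
    homology_class f (exist (fun x => Defs.cycle g x) _ (dc_cycle i))).
  apply/Zfree_homology_class => c a /= fa i.
  pose u : 'rV[rat]_r := \row_i ((c i)%:~R * (dc i).1%:~R).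
  have uM : u *m M = qrow (f a).
    rewrite fa mulmx_sum_row raddf_sum; apply: eq_bigr => k _.
    by rewrite raddfMz /= (dcP k).2 mxE -[RHS]scaler_int scalerA.
  (* This vector lies both in the image of [f] and in the chosen complement of it. *)
  have /eqP : u *m M = 0.
    apply/eqP; rewrite -submx0 -(capmx_diff (kermx (qmx g)) (qmx f)) sub_capmx.
    rewrite (submx_trans (submxMl _ _)) // uM -qrow_qmx submxMl //.
  rewrite mulmx_free_eq0 ?row_base_free // => /eqP /rowP /(_ i) /eqP.
  rewrite !mxE mulf_eq0 !intr_eq0 (negPf (dcP i).1) orbF.
  by move/eqP.
move=> n v vfree.
have /choice[z zE] i := homology_classP (v i).
have {}vfree : Zfree (fun i => homology_class f (z i)).
  by move=> c; under eq_bigr do rewrite -zE; apply: vfree.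
move/Zfree_homology_class: vfree => zfree.
pose M : 'M[rat]_(n, #|J|) := \matrix_i qrow (val (z i)).
have subM : (M <= kermx (qmx g))%MS.
  apply/row_subP => i; apply/sub_kermxP; rewrite rowK qrow_qmx.
  by have /eqP-> := valP (z i); rewrite raddf0.
(* Upper bound: a rational combination of the cycles lying in the image of [f] becomes an integral
   relation between classes. *)
have M_indep (u : 'rV_n) : (u *m M <= qmx f)%MS -> u = 0.
  move=> /submxP[w uw].
  (* Joining [u] and [w] into one vector gives a single denominator [d] for both sides of the
     relation. *)
  pose uw' : {ffun 'I_n + I -> rat} :=
    [ffun k => match k with inl i => u 0 i | inr i => w 0 (enum_rank i) end].
  have [d d0 [c /rowP cE]] := clear_denominators (\row_k uw' (enum_val k)).
  have cuE i : (c (inl i))%:~R = d%:~R * u 0 i.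
    by have := cE (enum_rank (inl i)); rewrite !mxE enum_rankK ffunE.
  have cwE i : (c (inr i))%:~R = d%:~R * w 0 (enum_rank i).
    by have := cE (enum_rank (inr i)); rewrite !mxE enum_rankK ffunE.
  have fa : f [ffun i => c (inr i)] = \sum_i val (z i) *~ c (inl i).
    apply: qrow_inj; rewrite -qrow_qmx.
    have := qrow_sum _ z [ffun i => c (inl i)].
    under eq_bigr do rewrite ffunE.
    move->; rewrite -/M.
    have -> : qrow [ffun i => c (inr i)] = d%:~R *: w.
      by apply/rowP => j; rewrite !mxE ffunE cwE enum_valK.
    rewrite -scalemxAl -uw scalemxAl; congr (_ *m _).
    by apply/rowP => j; rewrite !mxE ffunE cuE.
  apply/rowP => i; apply/eqP; move: (cuE i).
  rewrite (zfree _ _ fa) => /esym/eqP.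
  by rewrite mulf_eq0 intr_eq0 (negPf d0) mxE.
have Mfree : row_free M.
  by apply/inj_row_free => u uM0; apply: M_indep; rewrite uM0 sub0mx.
have capMf : (M :&: qmx f)%MS = 0.
  apply/eqP/rowV0P => x; rewrite sub_capmx => /andP[/submxP[u ->]].
  by move=> /M_indep ->; rewrite mul0mx.
have := mxrank_cap_compl (kermx (qmx g)) (qmx f).
rewrite -/r (capmx_idPr sub_fg) => rE.
rewrite -(leq_add2r (\rank (qmx f))) [(r + _)%N]addnC rE -{1}(eqP Mfree).
by rewrite -mxrank_disjoint_sum // mxrankS // addsmx_sub subM.
Qed.

End RationalRows.

(** * Distances and lengths *)

Section Distances.

Variables (V : choiceType) (H : {fset {fset V}}).
Implicit Types (s t u : H) (p q : seq H).

Lemma dist_SomeP s t m :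
  dist s t = Some m <->
  has_path_of_length s t m /\ forall n, has_path_of_length s t n -> (m <= n)%N.
Proof.
rewrite /dist; case: pselect => [ex|noex]; last first.
  by split=> // -[pm _]; case: noex; exists m.
case: ex_minnP => k pk kmin; split=> [[<-] //|[pm mmin]].
by congr Some; apply/eqP; rewrite eqn_leq kmin // mmin.
Qed.

Lemma dist_le s t m :
  has_path_of_length s t m -> exists2 n, dist s t = Some n & (n <= m)%N.
Proof.
move=> pm; rewrite /dist; case: pselect => [ex|[]]; last by exists m.
by case: ex_minnP => k pk kmin; exists k => //; apply: kmin.
Qed.

Lemma dist_refl s : dist s s = Some 0%N.
Proof.
apply/dist_SomeP; split=> //; apply/asboolP.
by exists [::] => //; rewrite /is_path /= eqxx.
Qed.

Lemma dist_eq0 s t : (dist s t == Some 0%N) = (s == t).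
Proof.
apply/eqP/eqP => [|->]; last exact: dist_refl.
case/dist_SomeP => /asboolP[p /andP[_ /eqP <-] /eqP len0] _; move: len0.
elim: p s => //= u p IH s.
rewrite /path_length /= addn_eq0 => /andP[su /IH <-]; apply/eqP; move: su.
by rewrite /step_length; case: ifP => //; case: ifP.
Qed.

Lemma dist_triangle s t u m n :
  dist s t = Some m -> dist t u = Some n ->
  exists2 l, dist s u = Some l & (l <= m + n)%N.
Proof.
move=> /dist_SomeP[/asboolP[p /andP[pp /eqP pt] pm] _].
move=> /dist_SomeP[/asboolP[q /andP[qq qu] qn] _].
apply: dist_le; apply/asboolP; exists (p ++ q).
  by rewrite /is_path cat_path last_cat pp pt qq.
by rewrite -pm -qn /path_length -pt pairmap_cat sumn_cat.
Qed.

Lemma tuple_length_cons2 s t p :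
  tuple_length [:: s, t & p] = oaddn (dist s t) (tuple_length (t :: p)).
Proof. by []. Qed.

Lemma tuple_length_cons2_Some s t p m :
  tuple_length [:: s, t & p] = Some m ->
  exists d l, [/\ dist s t = Some d, tuple_length (t :: p) = Some l &
                  m = (d + l)%N].
Proof.
rewrite tuple_length_cons2; case: (dist s t) => // d.
by case: (tuple_length _) => // l [<-]; exists d, l.
Qed.

(** Deletion on plain sequences: iterating it involves no change of tuple type. *)
Fixpoint del (T : Type) (i : nat) (x : seq T) : seq T :=
  if x is a :: x' then if i is i'.+1 then a :: del i' x' else x' else [::].

Lemma del_nil (T : Type) i : del i [::] = [::] :> seq T.
Proof. by case: i. Qed.

(** The simplicial identity for faces. *)
Lemma del_del (T : Type) i j (x : seq T) :
  (j < i)%N -> del j (del i x) = del i.-1 (del j x).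
Proof.
elim: x i j => [i j _|a x IH [|i] [|j] //= ji]; first by rewrite !del_nil.
by case: i ji => // i ji; rewrite (IH i.+1).
Qed.

Lemma size_del (T : Type) i (x : seq T) :
  (i < size x)%N -> size (del i x) = (size x).-1.
Proof.
elim: x i => [|a x IH] [|i] //= ix; rewrite IH //.
by case: x ix {IH}.
Qed.

Lemma nth_del (T : Type) (a : T) i j (x : seq T) :
  nth a (del i x) j = nth a x (bump i j).
Proof.
elim: x i j => [|b x IH] [|i] [|j] //=.
- by rewrite /bump nth_nil.
- by rewrite IH /bump /= addnS.
Qed.

Definition hneq : rel H := fun s t => s != t.

(* Deleting an entry may shorten a tuple; when it does not, the deleted entry *)
(* lay on a geodesic between its neighbours, which are therefore distinct.    *)
Lemma tuple_length_del i (x : seq H) m :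
  (1 < size x)%N -> tuple_length x = Some m ->
  exists2 l, tuple_length (del i x) = Some l &
    (l <= m)%N /\ (sorted hneq x -> l = m -> sorted hneq (del i x)).
Proof.
have dist_gt0 s t d : hneq s t -> dist s t = Some d -> (0 < d)%N.
  by rewrite /hneq -dist_eq0 lt0n => /[swap] ->.
case: x => // s x; elim: i s x m => [|i IH] s [//|t x] m _.
  move=> /tuple_length_cons2_Some[d [l [dE lE ->]]].
  by exists l => //; split=> [|/andP[_]//]; apply: leq_addl.
move=> /tuple_length_cons2_Some[d [l [dE lE ->]]].
case: i IH => [_|i IH].
  case: x lE => [_|u x /tuple_length_cons2_Some]; first by exists 0%N.
  move=> [d' [l' [d'E l'E ->]]].
  (* Deleting [t] replaces $d+d'$ by $e$. If the total is unchanged then $e=d+d'>0$, which rules out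
     [s = u]. *)
  have [e eE ele] := dist_triangle dE d'E.
  exists (e + l')%N; first by rewrite [del _ _]/= tuple_length_cons2 eE l'E.
  split=> [|/and3P[st _ sx] eq]; first by rewrite addnA leq_add2r.
  apply/andP; split=> //; apply/eqP => su.
  have := dist_gt0 _ _ _ st dE.
  by move: eq; have := dist_refl s; rewrite {2}su eE => -[->]; lia.
case: x lE => [lE|u x lE].
  rewrite [del _ _]/= del_nil; exists (d + l)%N => //.
  by rewrite tuple_length_cons2 dE lE.
have [l' l'E [le srt]] := IH t (u :: x) l isT lE.
exists (d + l')%N; last split.
- by rewrite [del _ _]/= tuple_length_cons2 dE l'E.
- by rewrite leq_add2l.
- by move=> /andP[st /srt{}srt] /addnI/srt ?; apply/andP.
Qed.

End Distances.

(** * The magnitude complex *)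

(** The terms with [j < i] cancel against those with [i <= j]: the pair [(i, j)] is matched with
    [(j, i.-1)], which has the same value and the opposite sign. *)
Lemma alternating_simplicial_sum (A : zmodType) (g : nat -> nat -> A) n :
    (forall i j, (j < i)%N -> g i j = g j i.-1) ->
  \sum_(i < n.+1) (\sum_(j < n) g i j *~ (-1) ^+ j) *~ (-1) ^+ i = 0.
Proof.
move=> gC; pose a i j := g i j *~ ((-1) ^+ j * (-1) ^+ i).
have -> : \sum_(i < n.+1) (\sum_(j < n) g i j *~ (-1) ^+ j) *~ (-1) ^+ i =
          \sum_(i < n.+1) \sum_(j < n | (j < i)%N) a i j +
          \sum_(i < n.+1) \sum_(j < n | (i <= j)%N) a i j.
  rewrite -big_split; apply: eq_bigr => i _ /=.
  rewrite mulrz_suml (bigID (fun j : 'I_n => (j < i)%N)) /=.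
  congr (_ + _); first by apply: eq_bigr => j _; rewrite -mulrzA.
  apply: eq_big => [j|j _]; first by rewrite [RHS]leqNgt.
  by rewrite -mulrzA.
(* The outer index 0 has no [j < i] and the outer index [n] has no [j >= i]; without them both sums
   have [n] outer indices, shifted by one. *)
rewrite big_ord_recl [X in X + _ + _]big1 // add0r.
rewrite [X in _ + X]big_ord_recr /= [X in _ + (_ + X)]big1 => [|j]; last first.
  by rewrite leqNgt ltn_ord.
rewrite addr0 [X in _ + X](exchange_big_dep xpredT) //= -big_split.
apply: big1 => i _ /=; rewrite /bump /= add1n.
rewrite -[X in X + _]opprK -sumrN addrC; apply/eqP; rewrite subr_eq0; apply/eqP.
apply: eq_bigr => j ji; rewrite /a [g i.+1 j]gC //= exprS.
by rewrite mulN1r mulrN mulrNz opprK mulrC.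
Qed.

Section Boundary.

Variables (V : choiceType) (H : {fset {fset V}}).

(** Extending generators by zero to all sequences turns every face into a plain deletion, whether or
    not its length drops. *)
Definition MC_of_seq k m (x : seq H) : MC H k m :=
  [ffun y => (x == val (val y))%:Z].

Lemma MC_of_seq_gen k m (y : MC_basis H k m) :
  MC_of_gen y = MC_of_seq k m (val (val y)).
Proof. by apply/ffunP => z; rewrite !ffunE. Qed.

Lemma MC_of_seq0 k m (x : k.+1.-tuple H) :
  ~~ MC_gen m x -> MC_of_seq k m x = 0.
Proof.
move=> /negP xN; apply/ffunP => y; rewrite !ffunE.
by case: eqP => // /val_inj xy; case: xN; rewrite xy (valP y).
Qed.

Lemma omit_del k (i : 'I_k.+2) (x : k.+2.-tuple H) :
  omit i x = del i x :> seq H.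
Proof.
apply: (@eq_from_nth _ (tnth x ord0)) => [|j].
  by rewrite size_tuple size_del size_tuple.
rewrite size_tuple => jk; rewrite nth_del.
rewrite -[j]/(val (Ordinal jk)) -[in LHS]tnth_nth tnth_mktuple.
by rewrite (tnth_nth (tnth x ord0)).
Qed.

Lemma MC_face_del k m i (x : MC_basis H k.+1 m) :
  MC_face i x = MC_of_seq k m (del i (val (val x))).
Proof.
rewrite /MC_face -omit_del; case: insubP => [y _ <-|/MC_of_seq0 -> //].
exact: MC_of_seq_gen.
Qed.

Lemma MC_bd_of_gen k m (x : MC_basis H k.+1 m) :
  MC_bd (MC_of_gen x) =
  \sum_(i < k.+2) MC_of_seq k m (del i (val (val x))) *~ (-1) ^+ i.
Proof.
rewrite /MC_bd [LHS](bigD1 x) //= [X in _ + X]big1; last first.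
  by move=> y /negPf yx; rewrite ffunE eq_sym yx mulr0z.
rewrite addr0 ffunE eqxx mulr1z; apply: eq_bigr => i _.
by rewrite MC_face_del.
Qed.

(** If a face is discarded, its length is already below [m], and further deletions cannot restore
    it; both sides are then zero. *)
Lemma MC_bd_of_seq_del k m (i : 'I_k.+3) (x : MC_basis H k.+2 m) :
  MC_bd (MC_of_seq k.+1 m (del i (val (val x)))) =
  \sum_(j < k.+2) MC_of_seq k m (del j (del i (val (val x)))) *~ (-1) ^+ j.
Proof.
rewrite -omit_del.
have [xi_gen|xi_Ngen] := boolP (MC_gen m (omit i (val x))).
  pose y : MC_basis H k.+1 m := Sub (omit i (val x)) xi_gen.
  have -> : omit i (val x) = val y by rewrite SubK.
  by rewrite -MC_of_seq_gen MC_bd_of_gen.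
rewrite MC_of_seq0 // raddf0 big1 // => j _.
rewrite -omit_del MC_of_seq0 ?mul0rz //; apply: contra xi_Ngen.
have sz_x : size (val (val x)) = k.+3 by rewrite size_tuple.
have /andP[srt /eqP len] := valP x.
have [|l lE [le_lm srt_xi]] := tuple_length_del i _ len; first by rewrite sz_x.
have [|l' l'E [le_l'l _]] := tuple_length_del j _ lE.
  by rewrite size_del sz_x.
rewrite /MC_gen !omit_del lE l'E => /andP[_ /eqP[l'm]].
have lm : l = m by apply/eqP; rewrite eqn_leq le_lm -l'm.
by rewrite lm eqxx srt_xi.
Qed.

Lemma MC_bd_bd k m (c : MC H k.+2 m) : MC_bd (MC_bd c) = 0.
Proof.
have -> : c = \sum_x MC_of_gen x *~ c x.
  apply/ffunP => y; rewrite sum_ffunE (bigD1 y) //= big1 => [|x /negPf yx].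
    by rewrite addr0 ffunMzE ffunE eqxx intz.
  by rewrite ffunMzE ffunE yx mul0rz.
rewrite (raddf_sum (@MC_bd V H k.+1 m)) (raddf_sum (@MC_bd V H k m)).
apply: big1 => x _; rewrite !raddfMz /= MC_bd_of_gen.
rewrite (raddf_sum (@MC_bd V H k m)).
under eq_bigr do rewrite raddfMz /= MC_bd_of_seq_del.
pose g i j := MC_of_seq k m (del j (del i (val (val x)))).
rewrite (@alternating_simplicial_sum _ g) ?mul0rz //.
by move=> i j ji; rewrite /g del_del.
Qed.

End Boundary.

(** * Expansion of the magnitude *)

Lemma sum_tupleS (R : nmodType) (T : finType) k (F : seq T -> R) :
  \sum_(x : k.+1.-tuple T) F x = \sum_(a : T) \sum_(x : k.-tuple T) F (a :: x).
Proof.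
rewrite pair_big /=.
rewrite (reindex (fun ax : T * k.-tuple T => cons_tuple ax.1 ax.2)) //=.
exists (fun x => (thead x, behead_tuple x)) => [[a x] _|x _] /=.
  by rewrite theadE; congr (_, _); apply: val_inj.
by rewrite [RHS]tuple_eta; apply: val_inj.
Qed.

(** Expanding the matrix product gives a sum over walks of [k] steps from [a], by induction on the
    first step; summing over [j] frees the endpoint. *)
Lemma mx_expr_row_sum (R : pzSemiRingType) (T : finType) (w : T -> T -> R) k
    (a : T) :
  \sum_j ((\matrix_(i < #|T|, j < #|T|) w (enum_val i) (enum_val j)) ^+ k)
           (enum_rank a) j =
  \sum_(x : k.-tuple T) \prod_(v <- pairmap w a x) v.
Proof.
set W := \matrix_(i, j) _.
elim: k a => [|k IH] a.
  rewrite (bigD1 (enum_rank a)) //= mxE eqxx big1 => [|j /negPf ja].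
    rewrite addr0 (bigD1 [tuple]) //= big_nil big1 ?addr0 // => x.
    by rewrite (tuple0 x) => /negP[].
  by rewrite mxE eq_sym ja.
rewrite (sum_tupleS k (fun x => \prod_(v <- pairmap w a x) v)) exprS -mulmxE.
transitivity (\sum_j \sum_i W (enum_rank a) i * (W ^+ k) i j).
  by apply: eq_bigr => j _; rewrite mxE.
rewrite exchange_big /=.
rewrite [RHS](reindex (fun i : 'I_#|T| => enum_val i)) /=; last first.
  exact: onW_bij (enum_val_bij T).
apply: eq_bigr => i _; rewrite -mulr_sumr -{2}[i]enum_valK IH.
rewrite mxE enum_rankK mulr_sumr; apply: eq_bigr => x _.
by rewrite big_cons.
Qed.

Definition mxsum (R : nmodType) n (A : 'M[R]_n) : R := \sum_i \sum_j A i j.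

Lemma mxsum_is_zmod_morphism (R : zmodType) n : zmod_morphism (@mxsum R n).
Proof.
move=> A B; rewrite /mxsum -sumrB; apply: eq_bigr => i _.
by rewrite -sumrB; apply: eq_bigr => j _; rewrite !mxE.
Qed.
HB.instance Definition _ (R : zmodType) n :=
  GRing.isZmodMorphism.Build _ _ (@mxsum R n) (@mxsum_is_zmod_morphism R n).

Lemma mxsumZ (R : pzRingType) n (a : R) (A : 'M[R]_n) :
  mxsum (a *: A) = a * mxsum A.
Proof.
rewrite /mxsum mulr_sumr; apply: eq_bigr => i _.
by rewrite mulr_sumr; apply: eq_bigr => j _; rewrite mxE.
Qed.

Lemma mxsum_map (R S : zmodType) (f : {additive R -> S}) n (A : 'M[R]_n) :
  mxsum (map_mx f A) = f (mxsum A).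
Proof.
rewrite /mxsum raddf_sum; apply: eq_bigr => i _.
by rewrite raddf_sum; apply: eq_bigr => j _; rewrite mxE.
Qed.

Section Weights.

Variables (V : choiceType) (H : {fset {fset V}}).

Definition qpoly (d : option nat) : {poly rat} :=
  if d is Some m then 'X^m else 0.

Lemma qpolyD a b : qpoly (oaddn a b) = qpoly a * qpoly b.
Proof. by case: a b => [m|] [n|] /=; rewrite ?mul0r ?mulr0 ?exprD. Qed.

(** The zero on the diagonal makes the product along a tuple vanish as soon as two consecutive
    entries agree, which is the condition on generators. *)
Definition weight (s t : H) : {poly rat} :=
  if s == t then 0 else qpoly (dist s t).

Lemma prod_weight s (x : seq H) :
  \prod_(v <- pairmap weight s x) v =
  if sorted (@hneq V H) (s :: x) then qpoly (tuple_length (s :: x)) else 0.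
Proof.
elim: x s => [|t x IH] s; first by rewrite big_nil.
rewrite tuple_length_cons2 qpolyD [pairmap _ _ _]/= big_cons IH.
rewrite /weight /= /hneq.
by case: eqP => _; rewrite ?mul0r //=; case: ifP; rewrite ?mulr0.
Qed.

Lemma coef_qpoly d m : (qpoly d)`_m = (d == Some m)%:R.
Proof.
case: d => [n|] /=; last by rewrite coef0.
by rewrite coefXn eq_sym.
Qed.

Definition Wmx : 'M[{poly rat}]_#|{: H}| :=
  \matrix_(i, j) weight (enum_val i) (enum_val j).

Lemma coef_sum_Wmx_exp k m :
  (\sum_i \sum_j (Wmx ^+ k) i j)`_m = #|{: MC_basis H k m}|%:R.
Proof.
rewrite (reindex enum_rank) /=; last exact: onW_bij (enum_rank_bij _).
under eq_bigr do rewrite mx_expr_row_sum.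
rewrite coef_sum; under eq_bigr do rewrite coef_sum.
transitivity (\sum_(x : k.+1.-tuple H) (MC_gen m x)%:R : rat).
  rewrite (sum_tupleS _ (fun x =>
    (sorted (@hneq V H) x && (tuple_length x == Some m))%:R)).
  apply: eq_bigr => s _; apply: eq_bigr => x _.
  rewrite prod_weight (fun_if (fun p : {poly rat} => p`_m)) coef_qpoly coef0.
  by case: sorted.
rewrite -natr_sum; congr _%:R; rewrite card_sig -sum1_card [RHS]big_mkcond.
by apply: eq_bigr => x _; rewrite inE; case: (MC_gen m x).
Qed.

Definition Zpmx : 'M[{poly rat}]_#|{: H}| :=
  \matrix_(i, j) qpoly (dist (enum_val i) (enum_val j)).

Lemma Zpmx_Wmx : Zpmx = 1 + Wmx.
Proof.
apply/matrixP => i j; rewrite !mxE /weight (inj_eq enum_val_inj).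
by case: eqP => [->|_]; rewrite ?dist_refl ?expr0 ?addr0 ?add0r.
Qed.

Lemma Zmx_Zpmx : Zmx H = map_mx (@FracField.tofrac _) Zpmx.
Proof.
by apply/matrixP => i j; rewrite !mxE; case: dist => [m|] //=; rewrite ?tofrac0.
Qed.

Lemma size_le_tuple_length s (x : seq H) m :
  sorted (@hneq V H) (s :: x) -> tuple_length (s :: x) = Some m ->
  (size x <= m)%N.
Proof.
elim: x s m => // t x IH s m /andP[st tx].
move=> /tuple_length_cons2_Some[d [l [dE lE ->]]].
have := IH _ _ tx lE; suff: (0 < d)%N by rewrite /=; lia.
by move: st; rewrite /hneq -dist_eq0 lt0n dE.
Qed.

Lemma card_MC_basis0 k m : (m < k)%N -> #|{: MC_basis H k m}| = 0%N.
Proof.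
move=> mk; apply/eqP; rewrite -leqn0 leqNgt; apply/negP => /card_gt0P[x _].
have /andP[] := valP x; have := size_tuple (val x).
case: (tval (val x)) => // s y [sz] /size_le_tuple_length le /eqP/le.
by rewrite sz leqNgt mk.
Qed.

Lemma coef_Wmx_exp_lt k i j m : (m < k)%N -> ((Wmx ^+ k) i j)`_m = 0.
Proof.
(* Distinct hyperedges have nonzero distance, so ['X] divides every entry of [Wmx], and ['X^k] every
   entry of its [k]-th power. *)
move=> mk; pose W' : 'M[{poly rat}]_#|{: H}| :=
  \matrix_(i, j) drop_poly 1 (Wmx i j).
have -> : Wmx = 'X *: W'.
  apply/matrixP => a b; rewrite !mxE /weight; case: eqP => [_|/eqP ab].
    by rewrite drop_poly0r mulr0.
  move: ab; rewrite -dist_eq0; case: dist => [[|d]|] //= _; last first.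
    by rewrite drop_poly0r mulr0.
  by rewrite exprSr drop_polyMXn_id mulrC.
have -> : ('X *: W') ^+ k = 'X^k *: W' ^+ k.
  elim: k {mk} => [|k IH]; first by rewrite !expr0 scale1r.
  by rewrite !exprS IH -!mulmxE -scalemxAl -scalemxAr scalerA.
by rewrite mxE coefXnM mk.
Qed.

(** At ['X = 0] only zero distances survive, so the matrix becomes the identity. *)
Lemma det_Zpmx_coef0 : (\det Zpmx)`_0 = 1.
Proof.
rewrite -horner_coef0 -[_.[0]]/(horner_eval 0 _) -det_map_mx.
rewrite (_ : map_mx _ _ = 1) ?det1 //; apply/matrixP => i j; rewrite !mxE.
rewrite [LHS]horner_coef0 coef_qpoly.
by rewrite -[_ == _]/(dist _ _ == Some 0%N) dist_eq0 (inj_eq enum_val_inj).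
Qed.

Lemma magnitudeE :
  magnitude H =
  FracField.tofrac (mxsum (\adj Zpmx)) / FracField.tofrac (\det Zpmx).
Proof.
have det0 : FracField.tofrac (\det Zpmx) != 0.
  rewrite tofrac_eq0; apply: contraTneq isT => det0.
  by have := det_Zpmx_coef0; rewrite det0 coef0 => /esym/eqP; rewrite oner_eq0.
rewrite /magnitude Zmx_Zpmx /invmx unitmxE det_map_mx unitfE det0.
by rewrite -map_mx_adj -[LHS]/(mxsum _) mxsumZ mxsum_map mulrC.
Qed.

(** The sum may stop at [n = m], as there are no generators of length [m] in higher degrees. *)
Definition euler_coef m : int :=
  \sum_(n < m.+1) (-1) ^+ n * #|{: MC_basis H n m}|%:Z.

Lemma exprN_mx (R : pzRingType) n (A : 'M[R]_n) k :
  (- A) ^+ k = (-1) ^+ k *: A ^+ k.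
Proof.
elim: k => [|k IH]; first by rewrite !expr0 scale1r.
rewrite [LHS]exprS IH -mulmxE mulNmx exprS mulN1r scaleNr; congr (- _).
apply/matrixP => i j; rewrite exprS !mxE mulr_sumr; apply: eq_bigr => l _.
by rewrite mxE !mulrA; congr (_ * _); apply: commr_sign.
Qed.

Lemma coef_mxsum_geometric N m : (m < N)%N ->
  (mxsum (\sum_(k < N) (- Wmx) ^+ k))`_m = (euler_coef m)%:~R.
Proof.
move=> mN; rewrite raddf_sum coef_sum /euler_coef rmorph_sum /=.
have termE k : (mxsum ((- Wmx) ^+ k))`_m =
               ((-1) ^+ k * #|{: MC_basis H k m}|%:Z)%:~R.
  rewrite exprN_mx mxsumZ -signr_odd -[_ ^+ (odd k)]/((-1) ^+ nat_of_bool _).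
  rewrite mulr_sign intrM [in RHS]rmorphXn /= rmorphN1.
  rewrite -(signr_odd _ k) mulr_sign.
  by case: (odd k); rewrite ?coefN coef_sum_Wmx_exp.
under eq_bigr do rewrite termE.
rewrite [RHS](big_ord_widen N (fun n =>
  ((-1) ^+ n * #|{: MC_basis H n m}|%:Z)%:~R)) //.
rewrite [RHS]big_mkcond; apply: eq_bigr => k _; case: ltnP => // mk.
by rewrite card_MC_basis0 // mulr0.
Qed.

Lemma expands_to_magnitude : expands_to (magnitude H) euler_coef.
Proof.
exists (mxsum (\adj Zpmx)), (\det Zpmx); split; first by rewrite det_Zpmx_coef0.
  exact: magnitudeE.
move=> m; pose S := \sum_(k < m.+1) (- Wmx) ^+ k.
(* The finite geometric sum times $1+W$ is $1-(-W)^{m+1}$; multiplying by the adjugate turns $1+W$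
   into the determinant. The remainder has no coefficient of degree at most [m]. *)
have detS : \det Zpmx *: S = \adj Zpmx - \adj Zpmx *m (- Wmx) ^+ m.+1.
  rewrite -{1}[\adj Zpmx]mulmx1 -mulmxBr -[1%:M - _]opprB subrX1 -/S -mulNr.
  by rewrite opprB opprK -Zpmx_Wmx -mulmxE mulmxA mul_adj_mx mul_scalar_mx.
transitivity (\det Zpmx * mxsum S)`_m.
  rewrite coefM; apply: eq_bigr => i _; rewrite coef_mxsum_geometric //.
  by rewrite ltnS leq_subr.
rewrite -mxsumZ detS raddfB coefB [X in _ - X](_ : _ = 0) ?subr0 //.
rewrite /mxsum coef_sum big1 // => i _; rewrite coef_sum big1 // => j _.
rewrite mxE coef_sum big1 // => k _; rewrite coefM big1 // => l _.
suff -> : ((- Wmx) ^+ m.+1) k j = (-1) ^+ odd m.+1 * (Wmx ^+ m.+1) k j.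
  rewrite mulr_sign.
  by case: odd; rewrite ?coefN coef_Wmx_exp_lt ?oppr0 ?mulr0 // ltnS leq_subr.
by rewrite exprN_mx mxE signr_odd.
Qed.

End Weights.

(** * Euler characteristics *)

Section Euler.
Variables (V : choiceType) (H : {fset {fset V}}).

(** The rank of the differential leaving degree [n], hence 0 in degree 0. *)
Definition bd_rank n m : nat :=
  if n is k.+1 then \rank (qmx (@MC_bd V H k m)) else 0%N.

Lemma zrank_MH n m :
  (zrank (MH H n m) + bd_rank n.+1 m + bd_rank n m)%N = #|{: MC_basis H n m}|.
Proof.
case: n => [|n] /=; last exact: zrank_homology (@MC_bd_bd V H n m).
apply: etrans (zrank_homology (f := @MC_bd V H 0 m)
  (g := \0%R : {additive MC H 0 m -> MC H 0 m}) _) => //.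
congr (_ + _)%N; apply/esym/eqP; rewrite mxrank_eq0; apply/eqP/row_matrixP => i.
by rewrite rowK row0 raddf0.
Qed.

Lemma sum_zrank_MH m :
  \sum_(n < m.+1) (-1) ^+ n * (zrank (MH H n m))%:Z = euler_coef H m.
Proof.
(* The partial sums telescope up to the rank of the differential leaving degree [N]. For [N = m.+1]
   that degree has no generators, so this rank is 0. *)
suff E N : \sum_(n < N) (-1) ^+ n * (zrank (MH H n m))%:Z =
    \sum_(n < N) (-1) ^+ n * #|{: MC_basis H n m}|%:Z
    + (-1) ^+ N * (bd_rank N m)%:Z.
  rewrite E; have := zrank_MH m.+1 m; rewrite card_MC_basis0 // => /eqP.
  by rewrite addn_eq0 => /andP[_ /eqP ->]; rewrite mulr0 addr0.
elim: N => [|N IH]; first by rewrite !big_ord0 mulr0.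
move: (bd_rank N.+1 m) (zrank_MH N m) => r rE.
rewrite !big_ord_recr /= IH -rE !PoszD !mulrDr exprS mulN1r mulNr.
rewrite [X in _ = _ + X - _]addrAC [in RHS]addrA addrK.
by rewrite [X in _ = _ + X]addrC addrA.
Qed.

End Euler.

Theorem theorem1p1 (V : choiceType) (H : {fset {fset V}})
    (H_nonempty : fset0 \notin H) :
  exists s : nat -> int,
    monomials_sum_to (fun n m => (-1) ^+ n * (zrank (MH H n m))%:Z) s /\
    expands_to (magnitude H) s.
Proof.
exists (euler_coef H); split; last exact: expands_to_magnitude.
move=> m; exists m.+1 => [n mn|]; last by rewrite sum_zrank_MH.
have := zrank_MH H n m; rewrite card_MC_basis0 // => /eqP.
by rewrite !addn_eq0 -andbA => /and3P[/eqP -> _ _]; rewrite mulr0.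
Qed.
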